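(* Let $n\ge 6$ and let $H$ be the bent linear 2-tree on $n$ vertices with a single bend located at vertex $k\in\{3,4,\ldots,n-3\}$ (defined in the context), with every edge having resistance $1$, and let $m=n-2$ be the number of triangles. Then the resistance distance between vertex $1$ and vertex $n$ is \[ r_{m,k}(1,n)=\frac{m+1}{5}+\frac{4F_{m+1}}{5L_{m+1}}+\frac{\sum_{j=3}^{k}\left[(-1)^jF_{m-2j+3}(F_{m+2}+F_{j-2}F_{m-j+1})\right]}{F_{2m+2}}, \] where $F_p$ is the $p$th Fibonacci number and $L_q$ is the $q$th Lucas number.
   Context: Fibonacci numbers: $F_0=0$, $F_1=1$, $F_{p+1}=F_p+F_{p-1}$, extended to negative indices by $F_{-r}=(-1)^{r+1}F_r$. Lucas numbers: $L_0=2$, $L_1=1$, $L_{q+1}=L_q+L_{q-1}$. The straight linear 2-tree $G_n$ is the graph with vertex set $\{1,\dots,n\}$ in which $\{i,j\}$ is an edge iff $0<|i-j|\le 2$. The bent linear 2-tree $H_n$ with bend at vertex $k$ has vertex set $\{1,\dots,n\}$ and edge set $(E(G_n)\cup\{\{k,k+3\}\})\setminus\{\{k+1,k+3\}\}$. The graph is viewed as an electrical network where each edge is a unit resistor; the resistance distance between vertices $i,j$ is $r(i,j)=(e_i-e_j)^T L^\dagger (e_i-e_j)$, where $L$ is the graph Laplacian and $L^\dagger$ its Moore–Penrose pseudoinverse. $r_{m,k}(1,n)$ denotes this resistance between vertices $1$ and $n$ in $H_n$. *)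

(* Defs.v *)
From HB Require Import structures.
From mathcomp Require Import all_boot all_order all_algebra.
Set Implicit Arguments.
Unset Strict Implicit.
Unset Printing Implicit Defensive.
Import Order.TTheory GRing.Theory Num.Theory.
Local Open Scope ring_scope.

Fixpoint fib (n : nat) : nat :=
  if n is n1.+1 then (if n1 is n2.+1 then fib n1 + fib n2 else 1)%N else 0%N.

(* F_{-r} = (-1)^{r+1} F_r; note that Negz r stands for -(r+1). *)
Definition fibz (p : int) : int :=
  match p with
  | Posz r => (fib r)%:Z
  | Negz r => (-1) ^+ r.+2 * (fib r.+1)%:Z
  end.

Fixpoint lucas (n : nat) : nat :=
  if n is n1.+1 then (if n1 is n2.+1 then lucas n1 + lucas n2 else 1)%N else 2%N.

(* The four Penrose equations (over a real field the adjoint is the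
   transpose); mpinv A below is their unique solution. *)
Definition penrose (R : realFieldType) (m n : nat)
    (A : 'M[R]_(m, n)) (B : 'M[R]_(n, m)) : bool :=
  [&& A *m B *m A == A, B *m A *m B == B,
      (A *m B)^T == A *m B & (B *m A)^T == B *m A].

Lemma row_sq_eq0 (R : realFieldType) (n : nat) (x : 'rV[R]_n) :
  x *m x^T = 0 -> x = 0.
Proof.
move=> /matrixP/(_ 0 0); rewrite !mxE => s0.
have s0' : \sum_j x 0 j ^+ 2 = 0.
  by rewrite -[RHS]s0; apply: eq_bigr => j _; rewrite mxE expr2.
apply/rowP => j; rewrite mxE; apply/eqP; rewrite -sqrf_eq0; apply/eqP.
exact: (psumr_eq0P (fun i _ => sqr_ge0 (x 0 i)) s0').
Qed.

Lemma gram_unit (R : realFieldType) (m n : nat) (A : 'M[R]_(m, n)) :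
  row_free A -> A *m A^T \in unitmx.
Proof.
move=> frA; rewrite -row_free_unit -kermx_eq0; apply/eqP/row_matrixP => i.
rewrite row0; set x := row i _.
have xA0 : x *m (A *m A^T) = 0 by rewrite -row_mul mulmx_ker row0.
have : x *m A = 0.
  by apply: row_sq_eq0; rewrite trmx_mul mulmxA -(mulmxA x) xA0 mul0mx.
by move=> xA; apply: (row_free_inj frA); rewrite xA mul0mx.
Qed.

Lemma penrose_ex (R : realFieldType) (m n : nat) (A : 'M[R]_(m, n)) :
  exists B, penrose A B.
Proof.
have uD : row_base A *m (row_base A)^T \in unitmx.
  by apply: gram_unit; exact: row_base_free.
have uC : (col_base A)^T *m col_base A \in unitmx.
  rewrite -{2}[col_base A]trmxK; apply: gram_unit.
  by rewrite /row_free mxrank_tr; exact: col_base_full.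
move: (col_base A) (row_base A) (mulmx_base A) uD uC.
move: (\rank A) => r C D /esym eA uD uC.
pose P := invmx (D *m D^T); pose Q := invmx (C^T *m C).
pose B := D^T *m P *m (Q *m C^T).
have eAB : A *m B = C *m Q *m C^T.
  by rewrite eA /B !mulmxA -(mulmxA C D) -(mulmxA C _ P) mulmxV // mulmx1.
have eBA : B *m A = D^T *m P *m D.
  by rewrite eA /B !mulmxA -(mulmxA _ C^T C) -(mulmxA _ Q) mulVmx // mulmx1.
exists B; apply/and4P; split; apply/eqP.
- by rewrite eAB eA !mulmxA -(mulmxA _ C^T C) -(mulmxA C Q) mulVmx // mulmx1.
- rewrite eBA /B !mulmxA -(mulmxA _ D D^T) -(mulmxA _ (D *m D^T)).
  by rewrite mulmxV // mulmx1.
- by rewrite eAB !trmx_mul trmxK trmx_inv trmx_mul trmxK mulmxA.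
- by rewrite eBA !trmx_mul trmxK trmx_inv trmx_mul trmxK mulmxA.
Qed.

Definition mpinv (R : realFieldType) (m n : nat) (A : 'M[R]_(m, n)) :
  'M[R]_(n, m) := xchoose (penrose_ex A).

Lemma mpinvP (R : realFieldType) (m n : nat) (A : 'M[R]_(m, n)) :
  penrose A (mpinv A).
Proof. exact: xchooseP. Qed.

Lemma penrose_uniq (R : realFieldType) (m n : nat) (A : 'M[R]_(m, n)) B B' :
  penrose A B -> penrose A B' -> B = B'.
Proof.
case/and4P=> /eqP b1 /eqP b2 /eqP b3 /eqP b4.
case/and4P=> /eqP c1 /eqP c2 /eqP c3 /eqP c4.
have eBA : B *m A = B' *m A.
  by rewrite -b4 -{1}c1 -(mulmxA A) mulmxA trmx_mul b4 c4 -mulmxA (mulmxA A) b1.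
have eAB : A *m B = A *m B'.
  by rewrite -b3 -{1}c1 -mulmxA trmx_mul b3 c3 mulmxA b1.
by rewrite -b2 eBA -mulmxA eAB mulmxA c2.
Qed.

Definition laplacian (R : realFieldType) (n : nat) (e : rel 'I_n) : 'M[R]_n :=
  \matrix_(i, j) (if i == j then #|[set v | e i v]|%:R else - (e i j)%:R).

Definition resistance (R : realFieldType) (n : nat) (e : rel 'I_n)
    (i j : 'I_n) : R :=
  let d : 'cV[R]_n := delta_mx i 0 - delta_mx j 0 in
  (d^T *m mpinv (laplacian R e) *m d) 0 0.

(* Vertices are labelled 1, ..., n. *)
Definition label (n : nat) (u : 'I_n) : nat := u.+1.

Definition is_pair (a b i j : nat) : bool :=
  ((i == a) && (j == b)) || ((i == b) && (j == a)).

Definition straight_2tree (n : nat) : rel 'I_n :=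
  fun u v => (0 < `|(label u)%:Z - (label v)%:Z| <= 2)%R.

Definition bent_2tree (n k : nat) : rel 'I_n :=
  fun u v =>
    (straight_2tree u v || is_pair k (k + 3) (label u) (label v))
    && ~~ is_pair (k + 1) (k + 3) (label u) (label v).

(* Main.v *)
(* Send a unit current from vertex 1 to vertex n: the resistance is the drop of
   a potential x with L x = e_1 - e_n.  Cutting the network between consecutive
   vertices of a straight 2-tree gives a linear recurrence whose solutions are
   -i/5 - (-1)^i (p L_{2i} + F_{2i}/5) up to a constant, with p free.  The bent
   2-tree is made of two straight ones, read from its two ends; with s = k - 1,
   t = n - k - 1 and m = s + t, the three linear equations at the bend have
   determinant F_{2m+2} up to sign, and fix both parameters.  The sum in the
   statement telescopes to (F_{s+1}^2 - F_s^2) (F_t^2 - F_{t+1}^2). *)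
Require Import Defs.
From HB Require Import structures.
From mathcomp Require Import all_boot all_order all_algebra.
From mathcomp Require Import zify ring lra.
Set Implicit Arguments.
Unset Strict Implicit.
Unset Printing Implicit Defensive.
Import Order.TTheory GRing.Theory Num.Theory.
Local Open Scope ring_scope.

(** * Fibonacci numbers *)

Lemma fibSS n : fib n.+2 = (fib n.+1 + fib n)%N.
Proof. by []. Qed.

Lemma fibD m n : fib (m + n).+1 = (fib m.+1 * fib n.+1 + fib m * fib n)%N.
Proof.
elim: m n => [|m IHm] n; first by rewrite /= add0n; lia.
by rewrite addSnnS IHm !fibSS; nia.
Qed.

Lemma fib_gt0 n : (0 < fib n.+1)%N.
Proof. by elim: n => // n IHn; rewrite fibSS; lia. Qed.

Lemma lucas_fib n : lucas n.+1 = (fib n + fib n.+2)%N.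
Proof.
suff: lucas n.+1 = (fib n + fib n.+2)%N /\ lucas n.+2 = (fib n.+1 + fib n.+3)%N.
  by case.
elim: n => // n [IH1 IH2]; split => //.
have -> : lucas n.+3 = (lucas n.+2 + lucas n.+1)%N by [].
by rewrite IH1 IH2 !fibSS; lia.
Qed.

Lemma fib_double n : fib n.+1.*2 = (fib n.+1 * lucas n.+1)%N.
Proof.
by rewrite -addnn addSn -addnS addnS fibD lucas_fib !fibSS; nia.
Qed.

Lemma fibzSS (p : int) : fibz (p + 2) = fibz (p + 1) + fibz p.
Proof.
case: p => [r|[|[|r]]] //.
  by rewrite -!PoszD !addn2 !addn1 /fibz fibSS PoszD.
have -> : Negz r.+2 + 2 = Negz r by lia.
have -> : Negz r.+2 + 1 = Negz r.+1 by lia.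
by rewrite /fibz !fibSS !PoszD !exprS; ring.
Qed.

(** d'Ocagne's identity, by strong induction on [s] with the Fibonacci recurrence read downwards. *)
Lemma fibz_subn (R : comRingType) (t s : nat) :
  (fibz (t%:Z - s%:Z))%:~R
  = (-1) ^+ s * ((fib t)%:R * (fib s.+1)%:R - (fib t.+1)%:R * (fib s)%:R) :> R.
Proof.
suff: fibz (t%:Z - s%:Z)
      = (-1) ^+ s * ((fib t)%:Z * (fib s.+1)%:Z - (fib t.+1)%:Z * (fib s)%:Z).
  move=> ->.
  by rewrite rmorphM rmorphXn rmorphN1 rmorphB !rmorphM /= !pmulrn.
elim/ltn_ind: s t => -[|[|s]] IHs t.
- by rewrite subr0 /= !expr0; lia.
- case: t => [|t]; first by [].
  rewrite (_ : t.+1%:Z - 1%:Z = t); last by lia.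
  by rewrite [fib t.+2]fibSS PoszD expr1 [fibz _]/= [fib 2]/= [fib 1]/=; lia.
have:= fibzSS (t%:Z - s.+2%:Z).
rewrite (_ : t%:Z - s.+2%:Z + 2 = t%:Z - s%:Z); last by lia.
rewrite (_ : t%:Z - s.+2%:Z + 1 = t%:Z - s.+1%:Z); last by lia.
rewrite (IHs s) // (IHs s.+1) // [fib s.+3]fibSS [fib s.+2]fibSS !PoszD !exprS.
by move: ((-1) ^+ s) (fibz _) => g y; lra.
Qed.

Section RealFib.
Variable R : realFieldType.
Implicit Types (s t i : nat).
Local Notation F n := ((fib n)%:R : R).

Lemma cassini i : (-1) ^+ i = F i.+1 ^+ 2 - F i.+1 * F i - F i ^+ 2.
Proof.
elim: i => [|i IHi]; first by rewrite expr0 /=; ring.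
by rewrite exprS IHi fibSS natrD; ring.
Qed.

(** Induction with m = s + 1 + t fixed: the last summand is the change of the product when the bend
    moves by one vertex, from (s, t+1) to (s+1, t). *)
Lemma bend_sum s t :
  \sum_(3 <= j < s.+3)
     (-1) ^+ j * (fibz ((s.+1 + t)%N%:Z - 2 * j%:Z + 3))%:~R
     * (F (s.+1 + t + 2)
        + (fibz (j%:Z - 2))%:~R * (fibz ((s.+1 + t)%N%:Z - j%:Z + 1))%:~R)
  = (F s.+2 ^+ 2 - F s.+1 ^+ 2) * (F t ^+ 2 - F t.+1 ^+ 2).
Proof.
elim: s t => [|s IHs] t; first by rewrite big_geq //= subrr mul0r.
rewrite big_nat_recr // (_ : s.+2 + t = s.+1 + t.+1)%N ?IHs; last by lia.
have -> : (s.+1 + t.+1)%N%:Z - 2 * s.+3%:Z + 3 = t.+1%:Z - s.+2%:Z by lia.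
have -> : s.+3%:Z - 2 = s.+1 by lia.
have -> : (s.+1 + t.+1)%N%:Z - s.+3%:Z + 1 = t by lia.
have -> : (s.+1 + t.+1 + 2)%N = (s.+2 + t.+1).+1 by lia.
rewrite fibz_subn fibD !fibSS [(-1) ^+ s.+3]exprS.
have e : (-1) ^+ s.+2 * (-1) ^+ s.+2 = 1 :> R by rewrite -expr2 sqrr_sign.
move: ((-1) ^+ s.+2) e => g e.
have cancel x y : -1 * g * (g * x) * y = - (x * y).
  by transitivity (- (g * g) * (x * y)); [ring | rewrite e mulN1r].
by rewrite cancel /= -!pmulrn !(natrD, natrM); ring.
Qed.

(** * Potentials *)

(* [X] is a potential on the vertices 0, 1, 2, ... of a straight 2-tree with a
   unit current entering at 0: the currents on the two or three edges crossing
   each cut {0, ..., i} | {i+1, ...} add up to 1. *)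
Definition unit_flow (X : nat -> R) :=
  2 * X 0%N - X 1%N - X 2%N = 1
  /\ forall i, 2 * X i.+1 + X i - 2 * X i.+2 - X i.+3 = 1.

(* The general solution, up to a constant: -i/5 - (-1)^i (p L_{2i} + F_{2i}/5),
   with L_{2i} and F_{2i} written as quadratic forms in F_i and F_{i+1}. *)
Definition flow_potential (p : R) i :=
  - i%:R / 5 - (-1) ^+ i
    * (p * (3 * F i ^+ 2 - 2 * F i * F i.+1 + 2 * F i.+1 ^+ 2)
       + F i * (2 * F i.+1 - F i) / 5).

Lemma flow_potentialP p : unit_flow (flow_potential p).
Proof.
split=> [|i]; first by rewrite /flow_potential !exprS expr0 /=; field.
by rewrite /flow_potential !fibSS !natrD !exprS -!natr1; field.
Qed.

(** The quadratic forms are F_{2i+1} and L_{2i+1}, through L_{2i} + L_{2i+2} = 5 F_{2i+1} and F_{2i}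
    + F_{2i+2} = L_{2i+1}. *)
Lemma flow_potentialB p i :
  flow_potential p i - flow_potential p i.+1
  = 1 / 5 - ((-1) ^+ i * p) * 5 * (F i ^+ 2 + F i.+1 ^+ 2)
    - (-1) ^+ i * (F i.+1 ^+ 2 + 4 * F i * F i.+1 - F i ^+ 2) / 5.
Proof.
by rewrite /flow_potential !fibSS !natrD !exprS -!natr1; field.
Qed.

(* With s = k - 1 in the 0-based labelling and t one less than in the header,
   vertices k, k+1, k+2 are [s], [s.+1], [s.+2] from the left, with [s.+2] at
   position [t] from the right; the straight 2-tree on the right continues with
   [s], [s.+1] at positions [t.+1], [t.+2].  The last equation is the balance of
   currents at the degree-3 vertex [s.+1], simplified by the cut equation of [X]
   that involves [s.-1], ..., [s.+2]. *)
Definition bend_matching s t (X Z : nat -> R) (b : R) :=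
  [/\ X s = b - Z t.+1, X s.+1 = b - Z t.+2
    & X s.+1 - (b - Z t) + X s - X s.+2 = 1].

(** The offset is chosen to satisfy the first matching equation; the other two are then linear in
    the parameters of [X] and [Z]. *)
Lemma bend_matching_ex s t :
  exists X Z b, [/\ unit_flow X, unit_flow Z, bend_matching s t X Z b
  & let m := (s + t.+1)%N in
    X 0%N - (b - Z 0%N) = (m + 1)%:R / 5
    + 4 * F (m + 1) / (5 * (lucas (m + 1))%:R)
    + (F s.+1 ^+ 2 - F s ^+ 2) * (F t.+1 ^+ 2 - F t.+2 ^+ 2)
       / F (2 * m + 2)].
Proof.
set a := F s; set b := F s.+1; set c := F t.+1; set d := F t.+2.
pose g : R := (-1) ^+ s; pose h : R := (-1) ^+ t.+1.
(* [F1], [F3], [G0], [G1] are F_{2s+1}, F_{2s+3}, F_{2t+1}, F_{2t+3}, so [D] is F_{2m+2} by F_{p+q}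
   = F_{p+1} F_{q+1} - F_{p-1} F_{q-1}. *)
pose F1 := a ^+ 2 + b ^+ 2; pose F3 := b ^+ 2 + (a + b) ^+ 2.
pose G1 := c ^+ 2 + d ^+ 2; pose G0 := (d - c) ^+ 2 + c ^+ 2.
pose D := F3 * G1 - F1 * G0.
pose y := 2 - g * (b ^+ 2 + 4 * a * b - a ^+ 2)
            - h * (d ^+ 2 + 4 * c * d - c ^+ 2).
pose z := 3 - g * ((a + b) ^+ 2 + 4 * b * (a + b) - b ^+ 2)
            - h * (c ^+ 2 + 4 * (d - c) * c - (d - c) ^+ 2).
have fD : F (2 * (s + t.+1) + 2) = D.
  have -> : (2 * (s + t.+1) + 2 = ((s + s).+1 + (t + t).+2).+1)%N by lia.
  rewrite fibD (_ : (t + t).+2 = (t.+1 + t).+1)%N; last by lia.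
  rewrite (_ : (t.+1 + t).+2 = (t.+1 + t.+1).+1)%N; last by lia.
  rewrite (_ : (s + s).+2 = (s.+1 + s).+1)%N; last by lia.
  rewrite !fibD /D /F3 /F1 /G1 /G0 /a /b /c /d !fibSS !(natrD, natrM).
  ring.
have D_neq0 : D != 0 by rewrite -fD addn2 pnatr_eq0 -lt0n fib_gt0.
have gg : g * g = 1 by rewrite /g -expr2 sqrr_sign.
have hh : h * h = 1 by rewrite /h -expr2 sqrr_sign.
have gE : g = b ^+ 2 - b * a - a ^+ 2 by rewrite /g cassini.
have hE : h = d ^+ 2 - d * c - c ^+ 2 by rewrite /h cassini.
(* Cramer's rule for [eq2] and [eq3], the last two matching equations times 5. The signs [g] and [h]
   enter because differences of potentials see p through (-1)^i p. *)
pose A := (z * G1 - y * G0) / (25 * D); pose B := (F3 * y - F1 * z) / (25 * D).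
pose X := flow_potential (g * A); pose Z := flow_potential (h * B).
have gA : g * (g * A) = A by rewrite mulrA gg mul1r.
have hB : h * (h * B) = B by rewrite mulrA hh mul1r.
have dX : X s - X s.+1 = 1 / 5 - A * 5 * F1
    - g * (b ^+ 2 + 4 * a * b - a ^+ 2) / 5.
  by rewrite flow_potentialB -/g gA.
have dX1 : X s.+1 - X s.+2 = 1 / 5 + A * 5 * F3
    + g * ((a + b) ^+ 2 + 4 * b * (a + b) - b ^+ 2) / 5.
  rewrite flow_potentialB exprS -/g -[-1 * g * _]mulrA gA fibSS natrD -/a -/b /F3.
  ring.
have dZ1 : Z t.+1 - Z t.+2 = 1 / 5 - B * 5 * G1
    - h * (d ^+ 2 + 4 * c * d - c ^+ 2) / 5.
  by rewrite flow_potentialB -/h hB.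
have dZ : Z t - Z t.+1 = 1 / 5 + B * 5 * G0
    + h * (c ^+ 2 + 4 * (d - c) * c - (d - c) ^+ 2) / 5.
  have ht : (-1) ^+ t = - h by rewrite /h exprS mulN1r opprK.
  have ft : F t = d - c by rewrite /d fibSS natrD addrAC subrr add0r.
  by rewrite flow_potentialB ht mulNr hB ft -/c /G0; ring.
have eq2 : A * 25 * F1 + B * 25 * G1 = y.
  by rewrite /A /B; move: D_neq0; rewrite /D => D_neq0; field.
have eq3 : A * 25 * F3 + B * 25 * G0 = z.
  by rewrite /A /B; move: D_neq0; rewrite /D => D_neq0; field.
exists X, Z, (X s + Z t.+1); split; [exact: flow_potentialP.. | | ].
  split; first by ring.
  - by move: dX dZ1 eq2; rewrite /y => dX dZ1 eq2; lra.
  - by move: dX1 dZ eq3; rewrite /z => dX1 dZ eq3; lra.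
move=> m; rewrite fD.
have Fm : F (m + 1) = b * d + a * c by rewrite addn1 /m fibD natrD !natrM.
(* F_{2m+2} = F_{m+1} L_{m+1} puts the Lucas quotient over [D]. *)
have Lm : D = (b * d + a * c) * (lucas (m + 1))%:R.
  by rewrite -fD -Fm -natrM addn1 -fib_double; congr (F _); rewrite /m; lia.
have [f_neq0 L_neq0] : b * d + a * c != 0 /\ (lucas (m + 1))%:R != 0 :> R.
  by apply/andP; rewrite -negb_or -mulf_eq0 -Lm.
have -> : 4 * F (m + 1) / (5 * (lucas (m + 1))%:R)
    = 4 * (b * d + a * c) ^+ 2 / (5 * D).
  by rewrite Fm Lm; field; rewrite L_neq0.
have X0 : X 0%N = - 2 * (g * A) by rewrite /X /flow_potential expr0 /=; field.
have Z0 : Z 0%N = - 2 * (h * B) by rewrite /Z /flow_potential expr0 /=; field.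
have Xs : X s = - s%:R / 5 - A * (3 * a ^+ 2 - 2 * a * b + 2 * b ^+ 2)
    - g * (a * (2 * b - a)) / 5.
  by rewrite /X /flow_potential -/g -/a -/b -[in RHS]gA; ring.
have Zt : Z t.+1 = - t.+1%:R / 5 - B * (3 * c ^+ 2 - 2 * c * d + 2 * d ^+ 2)
    - h * (c * (2 * d - c)) / 5.
  by rewrite /Z /flow_potential -/h -/c -/d -[in RHS]hB; ring.
(* Once Cassini's identity expresses [g] and [h] as quadratic forms, this is an
   identity between polynomials in [a], [b], [c], [d]. *)
have key : (z * G1 - y * G0) * (3 * a ^+ 2 - 2 * a * b + 2 * b ^+ 2 - 2 * g)
    + (F3 * y - F1 * z) * (3 * c ^+ 2 - 2 * c * d + 2 * d ^+ 2 - 2 * h)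
    + 5 * D * (g * (a * (2 * b - a)) + h * (c * (2 * d - c)))
    - 5 * D - 20 * (b * d + a * c) ^+ 2
    + 25 * (b ^+ 2 - a ^+ 2) * (d ^+ 2 - c ^+ 2)
  = (g * g - 1) * 10 * (a ^+ 2 * d ^+ 2 - a * b * c ^+ 2 + 2 * a * b * c * d
                        + a * b * d ^+ 2 + b ^+ 2 * c ^+ 2)
    + (h * h - 1) * 10 * (a ^+ 2 * d ^+ 2 - a ^+ 2 * c * d + 2 * a * b * c * d
                        + b ^+ 2 * c ^+ 2 + b ^+ 2 * c * d).
  by rewrite /D /y /z /F3 /F1 /G1 /G0 gE hE; ring.
move: key; rewrite gg hh subrr !mul0r addr0 => key.
rewrite X0 Z0 Xs Zt /m !natrD.
(* The difference of the two sides is the left side of [key] divided by 25 D. *)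
apply/eqP; rewrite -subr_eq0; apply/eqP.
rewrite -[RHS](mul0r (25 * D)^-1) -key /A /B.
by clearbody D; field.
Qed.
End RealFib.

(** * Networks *)

Section Network.
Variables (R : realFieldType) (n : nat).

Lemma laplacian_mulE (e : rel 'I_n) (x : 'cV[R]_n) i :
  irreflexive e ->
  (laplacian R e *m x) i 0 = \sum_(j | e i j) (x i 0 - x j 0).
Proof.
move=> irr_e; rewrite mxE (bigD1 i) //= mxE eqxx sumrB sumr_const.
rewrite mulr_natl; congr (_ *+ _ + _); first by apply: eq_card => j; rewrite inE.
rewrite -sumrN big_mkcond [RHS]big_mkcond /=; apply: eq_bigr => j _.
rewrite mxE [i == j]eq_sym; case: eqP => [->|_] /=; first by rewrite irr_e.
by case: (e i j); rewrite /= ?mulN1r // oppr0 mul0r.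
Qed.

(** With L symmetric, L^+ its pseudoinverse and d = L x, d^T L^+ d = x^T (L L^+ L) x = x^T d. *)
Lemma resistance_potential (e : rel 'I_n) (x : 'cV[R]_n) u v :
  symmetric e ->
  laplacian R e *m x = delta_mx u 0 - delta_mx v 0 ->
  resistance R e u v = x u 0 - x v 0.
Proof.
move=> sym_e Lx; rewrite /resistance -Lx.
have LT : (laplacian R e)^T = laplacian R e.
  apply/matrixP => i j; rewrite !mxE eq_sym sym_e.
  by case: eqP => [->|].
rewrite trmx_mul LT -!mulmxA [in X in _ *m X]mulmxA [X in _ *m X]mulmxA.
have /and4P[/eqP -> _ _ _] := mpinvP (laplacian R e).
by rewrite Lx mulmxBr -!colE !mxE.
Qed.

(** Lets a neighbourhood be given as an explicit list of naturals; the guard drops entries past the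
    last vertex. *)
Lemma sum_neighbours (e : rel 'I_n) (f : nat -> R) (u : 'I_n) (s : seq nat) :
  uniq s -> (forall w, e u w = (val w \in s)) ->
  \sum_(w | e u w) f w = \sum_(q <- s | (q < n)%N) f q.
Proof.
move=> uniq_s es; rewrite (eq_bigl _ _ es) -(big_mkord (fun q => q \in s) f).
rewrite -big_filter -[RHS]big_filter; apply: perm_big.
apply: uniq_perm => [||q]; rewrite ?filter_uniq ?iota_uniq //.
by rewrite !mem_filter mem_index_iota andbC.
Qed.

End Network.

(** * The bent linear 2-tree *)

Lemma straight_2treeE n (u v : 'I_n) :
  straight_2tree u v = [&& u != v, (u <= v.+2)%N & (v <= u.+2)%N].
Proof. by rewrite /straight_2tree /label -val_eqE /=; lia. Qed.

Lemma bent_2tree_sym n k : symmetric (@bent_2tree n k).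
Proof.
move=> u v.
by rewrite /bent_2tree !straight_2treeE /is_pair /label -!val_eqE /=; lia.
Qed.

Lemma bent_2tree_irr n k : irreflexive (@bent_2tree n k).
Proof.
move=> u.
by rewrite /bent_2tree straight_2treeE /is_pair /label eqxx /=; lia.
Qed.

(** Kirchhoff's law: away from the ends and the bend, the balance at a vertex is a difference of
    consecutive cut equations. Read from the right, the bend exchanges [s.+2] and [s.+3], which take
    positions [t.+2] and [t.+3]. *)
Lemma bent_potential (R : realFieldType) (s t : nat) (X Z : nat -> R) (b : R)
    (N : nat) (u : 'I_N.+1) :
  N = (s + t + 5)%N ->
  unit_flow X -> unit_flow Z -> bend_matching s.+2 t.+1 X Z b ->
  let x q := if (q <= s.+3)%N then X q else b - Z (N - q)%N in
  \sum_(w | bent_2tree s.+3 u w) (x u - x w)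
  = (u == 0%N :> nat)%:R - (u == N :> nat)%:R.
Proof.
move=> NE [X0 XS] [Z0 ZS] [m1 m2 m3] x.
set e := bent_2tree s.+3.
have xL q : (q <= s.+3)%N -> x q = X q by rewrite /x => ->.
have xR q j : (q + j = N)%N -> (j <= t.+1)%N -> x q = b - Z j.
  move=> qj jt; rewrite /x ifF; last by lia.
  by congr (b - Z _); rewrite -qj addKn.
have eE (w : 'I_N.+1) : e u w =
    [&& u != w :> nat, (u <= w.+2)%N & (w <= u.+2)%N]
      && ~~ is_pair (s.+3 + 1) (s.+3 + 3) u.+1 w.+1
    || is_pair s.+3 (s.+3 + 3) u.+1 w.+1.
  by rewrite /e /bent_2tree straight_2treeE /is_pair /label -val_eqE /=; lia.
clearbody x e.
have sumE l : uniq l -> (forall w, e u w = (nat_of_ord w \in l)) ->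
    \sum_(w | e u w) (x u - x w) = \sum_(q <- l | (q < N.+1)%N) (x u - x q).
  exact: (@sum_neighbours _ _ e (fun q => x u - x q)).
(* Vertices beyond the bend, at position [j] from the right end; for j = 0 and j = 1 some listed
   neighbours lie past [N]. *)
have rightE a1 a2 j : a1 != a2 -> (a1 < u)%N -> (a2 < u)%N ->
    (u + j = N)%N -> (j <= t.+1)%N ->
    x a1 = b - Z j.+2 -> x a2 = b - Z j.+1 ->
    (forall w, e u w = (nat_of_ord w \in [:: a1; a2; u.+1; u.+2])) ->
    \sum_(w | e u w) (x u - x w) = (u == 0%N :> nat)%:R - (u == N :> nat)%:R.
  move=> a12 a1u a2u uj jt xa1 xa2 /sumE -> //; last by rewrite /= !inE; lia.
  have a1N : (a1 < N.+1)%N by lia.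
  have a2N : (a2 < N.+1)%N by lia.
  have u0 : (u == 0%N :> nat) = false by lia.
  rewrite !big_cons big_nil a1N a2N xa1 xa2 (xR u j) // u0.
  case: j uj jt {xa1 xa2} => [|[|j]] uj jt.
  - have u1N : (u.+1 < N.+1)%N = false by lia.
    have u2N : (u.+2 < N.+1)%N = false by lia.
    have uN : u == N :> nat by lia.
    by rewrite u1N u2N uN /=; lra.
  - have u1N : (u.+1 < N.+1)%N by lia.
    have u2N : (u.+2 < N.+1)%N = false by lia.
    have uN : (u == N :> nat) = false by lia.
    have xu1 : x u.+1 = b - Z 0%N by apply: xR; lia.
    by rewrite u1N u2N uN xu1 /=; have := ZS 0%N; lra.
  - have u1N : (u.+1 < N.+1)%N by lia.
    have u2N : (u.+2 < N.+1)%N by lia.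
    have uN : (u == N :> nat) = false by lia.
    have xu1 : x u.+1 = b - Z j.+1 by apply: xR; lia.
    have xu2 : x u.+2 = b - Z j by apply: xR; lia.
    by rewrite u1N u2N uN xu1 xu2 /=; have := ZS j; have := ZS j.+1; lra.
have allE l : uniq l -> all (fun q => q < N.+1)%N l ->
    (forall w, e u w = (nat_of_ord w \in l)) ->
    \sum_(w | e u w) (x u - x w) = \sum_(q <- l) (x u - x q).
  move=> uniq_l /allP lN /sumE -> //; rewrite big_seq_cond [RHS]big_seq.
  by apply: eq_bigl => q; case: (boolP (q \in l)) => // /lN ->.
have xs4 : x s.+4 = b - Z t.+1 by apply: xR; lia.
have xs5 : x s.+1.+4 = b - Z t by apply: xR; lia.
have uleN : (u <= N)%N by rewrite -ltnS.
have [u_lt|u_gt|uE] := ltngtP u s.+3; last 2 first.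
- have [u4|u5|u6] := ltngtP u s.+1.+4.
  + have uE : u = s.+4 :> nat by lia.
    apply: (rightE s.+3 s.+2 t.+1); rewrite ?xL //; try lia.
    by move=> w; rewrite eE /is_pair !inE; lia.
  + apply: (rightE u.-2 u.-1 (N - u)%N); try lia.
    * by apply: xR; lia.
    * by apply: xR; lia.
    * by move=> w; rewrite eE /is_pair !inE; lia.
  + apply: (rightE s.+2 s.+4 t); rewrite ?[x s.+2]xL //; try lia.
    by move=> w; rewrite eE /is_pair !inE; lia.
(* At the degree-3 vertex, the value [X s.+4] in [m3] continues the left potential past the bend;
   the cut equation [XS s.+1] eliminates it. *)
- rewrite (allE [:: s.+1; s.+2; s.+4]); first last.
  + by move=> w; rewrite eE /is_pair !inE; lia.
  + by rewrite /=; lia.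
  + by rewrite /= !inE; lia.
  have u0 : (u == 0%N :> nat) = false by lia.
  have uN : (u == N :> nat) = false by lia.
  rewrite !big_cons big_nil u0 uN uE xs4 !xL //=; try lia.
  by have := XS s.+1; lra.
have uN : (u == N :> nat) = false by lia.
have [u2|u2] := ltnP u s.+2; last first.
  have uE : u = s.+2 :> nat by lia.
  rewrite (allE [:: s; s.+1; s.+3; s.+4; s.+1.+4]); first last.
  + by move=> w; rewrite eE /is_pair !inE; lia.
  + by rewrite /=; lia.
  + by rewrite /= !inE; lia.
  have u0 : (u == 0%N :> nat) = false by lia.
  rewrite !big_cons big_nil u0 uN uE xs4 xs5 !xL //=; try lia.
  by have := XS s; have := XS s.+1; have := ZS t; lra.
have xuL q : (q <= u.+2)%N -> x q = X q by move=> qu; apply: xL; lia.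
rewrite uN.
have [uE|[uE|[j uE]]] :
    u = 0%N :> nat \/ u = 1%N :> nat \/ exists j, u = j.+2 :> nat.
  by case: (nat_of_ord u) => [|[|j]]; [left | right; left | do 2 right; exists j].
- rewrite (allE [:: 1; 2]); first last.
  + by move=> w; rewrite eE /is_pair !inE; lia.
  + by rewrite /=; lia.
  + by [].
  by rewrite !big_cons big_nil uE !xuL ?uE //=; lra.
- rewrite (allE [:: 0; 2; 3]); first last.
  + by move=> w; rewrite eE /is_pair !inE; lia.
  + by rewrite /=; lia.
  + by [].
  by rewrite !big_cons big_nil uE !xuL ?uE //=; have := XS 0%N; lra.
rewrite (allE [:: j; j.+1; j.+3; j.+4]); first last.
- by move=> w; rewrite eE /is_pair !inE; lia.
- by rewrite /=; lia.
- by rewrite /= !inE; lia.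
rewrite !big_cons big_nil uE !xuL ?uE //=; try lia.
by have := XS j; have := XS j.+1; lra.
Qed.

Theorem theorem3p6 (R : realFieldType) (n m k : nat) (u v : 'I_n)
    (hn : (6 <= n)%N) (hk : (3 <= k <= n - 3)%N) (hm : m = (n - 2)%N)
    (hu : label u = 1%N) (hv : label v = n) :
  resistance R (bent_2tree k) u v =
    (m + 1)%:R / 5
    + 4 * (fib (m + 1))%:R / (5 * (lucas (m + 1))%:R)
    + (\sum_(3 <= j < k.+1)
         (-1) ^+ j * (fibz (m%:Z - 2 * j%:Z + 3))%:~R
         * ((fib (m + 2))%:R
            + (fibz (j%:Z - 2))%:~R * (fibz (m%:Z - j%:Z + 1))%:~R))
      / (fib (2 * m + 2))%:R.
Proof.
(* The bounds on [k] make k - 3 and n - k - 3 natural numbers; the bend has 0-based index [s.+2]. *)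
have [s sE] : exists s, k = s.+3 by exists (k - 3)%N; lia.
have [t tE] : exists t, n = (s + t + 5).+1 by exists (n - k - 3)%N; lia.
subst k n.
have mE : m = (s.+2 + t.+2)%N by lia.
have [X [Z [b [fX fZ XZb XZ0]]]] := bend_matching_ex R s.+2 t.+1.
set N := (s + t + 5)%N in u v hn hk hm hu hv *.
pose x q := if (q <= s.+3)%N then X q else b - Z (N - q)%N.
pose y : 'cV[R]_N.+1 := \col_q x q.
have u0 : u = 0%N :> nat by case: hu.
have vN : v = N :> nat by case: hv.
rewrite (@resistance_potential _ _ _ y); first last.
- apply/colP => w; rewrite laplacian_mulE; last exact: bent_2tree_irr.
  under eq_bigr do rewrite !mxE.
  by rewrite (bent_potential w erefl fX fZ XZb) !mxE -!val_eqE /= u0 vN !andbT.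
- exact: bent_2tree_sym.
have Nx : (N <= s.+3)%N = false by lia.
rewrite !mxE /x u0 vN subnn Nx leq0n.
by rewrite mE bend_sum XZ0.
Qed.
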